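(* The functors $\Omega_R:\mathbf{Top}\to \mathbf{Raney}^{op}$, $X\mapsto(\Omega(X),\mathcal{U}(X))$, $f\mapsto f^{-1}$, and $\mathsf{pt}_R:\mathbf{Raney}^{op}\to\mathbf{Top}$, $(L,C)\mapsto \mathsf{pt}_R(L,C)$, $f\mapsto f^*$, constitute an idempotent adjunction $\Omega_R\dashv \mathsf{pt}_R$. Raney duality (the dual equivalence between $T_0$ spaces and Raney extensions of the form $(\Omega(X),\mathcal{U}(X))$ for a space $X$, up to isomorphism) is the restriction of this adjunction to a dual equivalence.
   Context: A frame is a complete lattice in which finite meets distribute over arbitrary joins; frame maps preserve arbitrary joins and finite meets. A coframe is the order dual; coframe maps preserve arbitrary meets and finite joins. A coframe map $f$ has a left adjoint, denoted $f^*$. A meet $\bigwedge_i x_i$ in a frame $L$ is strongly exact if for all $y\in L$: $x_i\to y=y$ for all $i$ implies $(\bigwedge_i x_i)\to y=y$ ($\to$ is Heyting implication). A Raney extension is a pair $(L,C)$ where $C$ is a coframe, $L\subseteq C$ is a frame such that every element of $C$ is a meet of elements of $L$, and the inclusion $L\subseteq C$ preserves the frame operations (arbitrary joins, finite meets) and strongly exact meets of $L$. A morphism $f:(L,C)\to(M,D)$ is a coframe map $f:C\to D$ with $f[L]\subseteq M$ whose restriction $L\to M$ is a frame map. These form the category $\mathbf{Raney}$. For a space $X$, $\Omega(X)$ is its frame of opens and $\mathcal{U}(X)$ is the lattice of its saturated sets (intersections of open sets; equivalently upsets in the specialization preorder). The pair $(\Omega(X),\mathcal{U}(X))$ is always a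 Raney extension. For a Raney extension $(L,C)$, the space $\mathsf{pt}_R(L,C)$ has as points the completely join-prime elements of $C$ ($x$ such that $x\le\bigvee A$ implies $x\le a$ for some $a\in A$, for all $A\subseteq C$), with open sets $\{x: x\le a\}$ for $a\in L$. An adjunction $F:\mathcal{C}\leftrightarrows\mathcal{D}:G$ is idempotent if every object of the form $G(d)$ is a fixpoint (the unit at it is an isomorphism) and every object of the form $F(c)$ is a fixpoint (the counit at it is an isomorphism). *)

(* Defs.v *)
From HB Require Import structures.
From mathcomp Require Import all_boot all_order.
From mathcomp Require Import mathcomp_extra boolp classical_sets cardinality.
From mathcomp Require Import filter topology.

Set Implicit Arguments.
Unset Strict Implicit.
Unset Printing Implicit Defensive.

Import Order.TTheory.

Local Open Scope classical_set_scope.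
Local Open Scope order_scope.

Record category := Category {
  ob :> Type;
  hom : ob -> ob -> Type;
  idm : forall X, hom X X;
  comp : forall X Y Z, hom Y Z -> hom X Y -> hom X Z;
  comp_idl : forall X Y (f : hom X Y), comp (idm Y) f = f;
  comp_idr : forall X Y (f : hom X Y), comp f (idm X) = f;
  comp_assoc : forall X Y Z W (h : hom Z W) (g : hom Y Z) (f : hom X Y),
    comp h (comp g f) = comp (comp h g) f }.

Arguments idm {c} X.
Arguments comp {c X Y Z} _ _.

Definition op (C : category) : category := {|
  ob := C;
  hom := fun X Y => @hom C Y X;
  idm := fun X => @idm C X;
  comp := fun X Y Z g f => @comp C Z Y X f g;
  comp_idl := fun X Y f => @comp_idr C Y X f;
  comp_idr := fun X Y f => @comp_idl C Y X f;
  comp_assoc := fun X Y Z W h g f => esym (@comp_assoc C W Z Y X f g h) |}.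

Definition full_subcategory (C : category) (P : C -> Prop) : category := {|
  ob := {X : C | P X};
  hom := fun X Y => hom (sval X) (sval Y);
  idm := fun X => idm (sval X);
  comp := fun X Y Z g f => comp g f;
  comp_idl := fun X Y f => comp_idl f;
  comp_idr := fun X Y f => comp_idr f;
  comp_assoc := fun X Y Z W h g f => comp_assoc h g f |}.

Definition is_iso (C : category) (X Y : C) (f : hom X Y) : Prop :=
  exists g : hom Y X, comp g f = idm X /\ comp f g = idm Y.

Definition isomorphic (C : category) (X Y : C) : Prop :=
  exists f : hom X Y, is_iso f.

Record functor (C D : category) := Functor {
  fobj :> C -> D;
  fmap : forall X Y, hom X Y -> hom (fobj X) (fobj Y);
  fmap_id : forall X, fmap (idm X) = idm (fobj X);
  fmap_comp : forall X Y Z (g : hom Y Z) (f : hom X Y),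
    fmap (comp g f) = comp (fmap g) (fmap f) }.

Arguments fmap {C D} _ {X Y} _.

Definition restrict_functor (C D : category) (F : functor C D)
    (P : C -> Prop) (Q : D -> Prop) (FPQ : forall X, P X -> Q (F X)) :
    functor (full_subcategory P) (full_subcategory Q) :=
  @Functor (full_subcategory P) (full_subcategory Q)
    (fun X => exist Q (F (sval X)) (FPQ _ (svalP X)))
    (fun X Y (f : hom (sval X) (sval Y)) => fmap F f)
    (fun X => fmap_id F (sval X))
    (fun X Y Z g f => @fmap_comp _ _ F (sval X) (sval Y) (sval Z) g f).

(* F is the left adjoint. *)
Record adjunction (C D : category) (F : functor C D) (G : functor D C) :=
  Adjunction {
    adj_unit : forall X : C, hom X (G (F X));
    adj_counit : forall Y : D, hom (F (G Y)) Y;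
    adj_unit_nat : forall (X X' : C) (f : hom X X'),
      comp (adj_unit X') f = comp (fmap G (fmap F f)) (adj_unit X);
    adj_counit_nat : forall (Y Y' : D) (g : hom Y Y'),
      comp g (adj_counit Y) = comp (adj_counit Y') (fmap F (fmap G g));
    adj_triangle_left : forall X : C,
      comp (adj_counit (F X)) (fmap F (adj_unit X)) = idm (F X);
    adj_triangle_right : forall Y : D,
      comp (fmap G (adj_counit Y)) (adj_unit (G Y)) = idm (G Y) }.

Section AdjunctionProperties.
Variables (C D : category) (F : functor C D) (G : functor D C).
Variable A : adjunction F G.

Definition unit_fixpoint (X : C) : Prop := is_iso (adj_unit A X).

Definition counit_fixpoint (Y : D) : Prop := is_iso (adj_counit A Y).

Definition idempotent_adjunction : Prop :=
  (forall Y : D, unit_fixpoint (G Y)) /\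
  (forall X : C, counit_fixpoint (F X)).

Definition restrict_adjunction (P : C -> Prop) (Q : D -> Prop)
    (FPQ : forall X, P X -> Q (F X)) (GQP : forall Y, Q Y -> P (G Y)) :
    adjunction (restrict_functor FPQ) (restrict_functor GQP) :=
  @Adjunction (full_subcategory P) (full_subcategory Q)
    (restrict_functor FPQ) (restrict_functor GQP)
    (fun X => adj_unit A (sval X))
    (fun Y => adj_counit A (sval Y))
    (fun X X' f => @adj_unit_nat _ _ _ _ A (sval X) (sval X') f)
    (fun Y Y' g => @adj_counit_nat _ _ _ _ A (sval Y) (sval Y') g)
    (fun X => adj_triangle_left A (sval X))
    (fun Y => adj_triangle_right A (sval Y)).

End AdjunctionProperties.

Definition is_equivalence (C D : category) (F : functor C D) (G : functor D C)
    (A : adjunction F G) : Prop :=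
  (forall X : C, unit_fixpoint A X) /\ (forall Y : D, counit_fixpoint A Y).

(* The induced order on a subset of a poset ([set_type A] unfolds to a [sig]). *)
HB.instance Definition _ d (T : porderType d) (P : pred T) :=
  [SubChoice_isSubPOrder of {x : T | P x} by <: with d].

(* [supremums A s] and [infimums A m] say that s is the join, resp. m the
   meet, of A; they make sense in any poset, in particular in a subset of
   another one, where joins and meets are those of the induced order. *)

Section FrameDefs.
Context {d : Order.disp_t} (T : porderType d).

Definition complete_lattice : Prop :=
  forall A : set T, supremums A !=set0 /\ infimums A !=set0.

(* a /\ (\/ A) = \/ {a /\ x | x in A} *)
Definition is_frame : Prop :=
  complete_lattice /\
  forall (a : T) (A : set T) (s m : T),
    supremums A s -> infimums [set a; s] m ->
    supremums [set y | exists2 x, A x & infimums [set a; x] y] m.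

Definition is_heyting_imp (x y z : T) : Prop :=
  forall w m : T, infimums [set w; x] m -> (w <= z) = (m <= y).

Definition strongly_exact_meet (A : set T) (m : T) : Prop :=
  infimums A m /\
  forall y, (forall x, A x -> is_heyting_imp x y y) -> is_heyting_imp m y y.

Definition completely_join_prime (x : T) : Prop :=
  forall (A : set T) (s : T), supremums A s -> x <= s ->
    exists2 a, A a & x <= a.

End FrameDefs.

Definition is_coframe {d : Order.disp_t} (T : porderType d) : Prop :=
  is_frame (T^d)%O.

Section FrameMaps.
Context {d d' : Order.disp_t} (T : porderType d) (U : porderType d').

Definition frame_map (f : T -> U) : Prop :=
  (forall A s, supremums A s -> supremums (f @` A) (f s)) /\
  (forall A m, finite_set A -> infimums A m -> infimums (f @` A) (f m)).

Definition coframe_map (f : T -> U) : Prop :=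
  (forall A m, infimums A m -> infimums (f @` A) (f m)) /\
  (forall A s, finite_set A -> supremums A s -> supremums (f @` A) (f s)).

Definition left_adjoint (g : U -> T) (f : T -> U) : Prop :=
  forall y x, (g y <= x) = (y <= f x).

End FrameMaps.

Record is_raney_extension {d : Order.disp_t} (C : porderType d) (L : set C) :
    Prop := IsRaneyExtension {
  raney_is_coframe : is_coframe C;
  raney_is_frame : is_frame (set_type L);
  raney_dense : forall c : C, exists2 A : set C, A `<=` L & infimums A c;
  raney_frame_map : frame_map (val : set_type L -> C);
  raney_strongly_exact : forall (A : set (set_type L)) (m : set_type L),
    strongly_exact_meet A m -> infimums (val @` A : set C) (val m) }.

Record raney_extension := RaneyExtension {
  raney_disp : Order.disp_t;
  raney_coframe :> porderType raney_disp;
  raney_frame : set raney_coframe;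
  raneyP : is_raney_extension raney_frame }.

Arguments raney_frame R : rename, clear implicits.

(* The second conjunct says that f maps L into M and that its restriction
   g : L -> M is a frame map. *)
Definition raney_morphism (R S : raney_extension) (f : R -> S) : Prop :=
  coframe_map f /\
  exists2 g : set_type (raney_frame R) -> set_type (raney_frame S),
    (forall a, val (g a) = f (val a)) & frame_map g.

Lemma set_type_leE d (T : porderType d) (A : set T) (x y : set_type A) :
  (x <= y) = (val x <= val y).
Proof. by []. Qed.

Lemma frame_map_id d (T : porderType d) : frame_map (@id T).
Proof. by split=> A s; rewrite image_id. Qed.

Lemma coframe_map_id d (T : porderType d) : coframe_map (@id T).
Proof. by split=> A s; rewrite image_id. Qed.

Lemma frame_map_comp d d' d'' (T : porderType d) (U : porderType d')
    (V : porderType d'') (g : U -> V) (f : T -> U) :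
  frame_map g -> frame_map f -> frame_map (g \o f).
Proof.
move=> [gs gi] [fs fi]; split=> A s; rewrite -[(g \o f) @` A]image_comp.
  by move=> /fs/gs.
by move=> fA /(fi _ _ fA)/gi; apply; exact: finite_image.
Qed.

Lemma coframe_map_comp d d' d'' (T : porderType d) (U : porderType d')
    (V : porderType d'') (g : U -> V) (f : T -> U) :
  coframe_map g -> coframe_map f -> coframe_map (g \o f).
Proof.
move=> [gi gs] [fi fs]; split=> A s; rewrite -[(g \o f) @` A]image_comp.
  by move=> /fi/gi.
by move=> fA /(fs _ _ fA)/gs; apply; exact: finite_image.
Qed.

Lemma raney_morphism_id (R : raney_extension) : raney_morphism (@id R).
Proof. by split; [exact: coframe_map_id|exists id => //; exact: frame_map_id]. Qed.

Lemma raney_morphism_comp (R S T : raney_extension) (g : S -> T) (f : R -> S) :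
  raney_morphism g -> raney_morphism f -> raney_morphism (g \o f).
Proof.
move=> [cg [g' g'E fg']] [cf [f' f'E ff']]; split; first exact: coframe_map_comp.
by exists (g' \o f') => [a|]; [rewrite /= g'E f'E|exact: frame_map_comp].
Qed.

Definition raney_hom (R S : raney_extension) := {f : R -> S | raney_morphism f}.

Lemma raney_hom_eq (R S : raney_extension) (f g : raney_hom R S) :
  sval f =1 sval g -> f = g.
Proof. by case: f g => [f fP] [g gP] /= /funext fg; exact: eq_exist. Qed.

Definition raney_idm (R : raney_extension) : raney_hom R R :=
  exist _ id (raney_morphism_id R).

Definition raney_comp (R S T : raney_extension) (g : raney_hom S T)
    (f : raney_hom R S) : raney_hom R T :=
  exist _ (sval g \o sval f) (raney_morphism_comp (svalP g) (svalP f)).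

Definition Raney : category := {|
  ob := raney_extension;
  hom := raney_hom;
  idm := raney_idm;
  comp := raney_comp;
  comp_idl := fun R S f =>
    @raney_hom_eq R S (raney_comp (raney_idm S) f) f (fun=> erefl);
  comp_idr := fun R S f =>
    @raney_hom_eq R S (raney_comp f (raney_idm R)) f (fun=> erefl);
  comp_assoc := fun R S T V h g f =>
    @raney_hom_eq R V (raney_comp h (raney_comp g f))
      (raney_comp (raney_comp h g) f) (fun=> erefl) |}.

Definition cts_idm (X : topologicalType) : continuousType X X := idfun.

Definition cts_comp (X Y Z : topologicalType) (g : continuousType Y Z)
    (f : continuousType X Y) : continuousType X Z := g \o f.

Definition cts_eq (X Y : topologicalType) (f g : continuousType X Y) :
  f =1 g -> f = g := proj2 (continuousEP f g).

Definition Top : category := {|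
  ob := topologicalType;
  hom := fun X Y => continuousType X Y;
  idm := cts_idm;
  comp := cts_comp;
  comp_idl := fun X Y f =>
    @cts_eq X Y (cts_comp (cts_idm Y) f) f (fun=> erefl);
  comp_idr := fun X Y f =>
    @cts_eq X Y (cts_comp f (cts_idm X)) f (fun=> erefl);
  comp_assoc := fun X Y Z W h g f =>
    @cts_eq X W (cts_comp h (cts_comp g f)) (cts_comp (cts_comp h g) f)
      (fun=> erefl) |}.

Section SpaceRaney.
Variable X : topologicalType.

Definition saturated : set (set X) :=
  [set A | exists2 F : set (set X), F `<=` open & A = \bigcap_(U in F) U].

Definition saturated_sets := set_type saturated.

Definition open_sets : set saturated_sets := [set A | open (val A)].

Lemma saturatedP (A : set X) : saturated A <->
  forall x y, A x -> (forall U, open U -> U x -> U y) -> A y.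
Proof.
split=> [[F Fo ->] x y Ax xy U FU|Aup].
  by apply: xy; [exact: Fo|exact: Ax].
exists [set U | open U /\ A `<=` U] => [U []//|].
apply/seteqP; split=> [x Ax U [_]|y Fy]; first exact.
apply: contrapT => nAy.
pose V := \bigcup_(U in [set U : set X | open U /\ ~ U y]) U.
suff /Fy[U []] : [set U | open U /\ A `<=` U] V by [].
split=> [|x Ax]; first by apply: bigcup_open => U [].
apply: contrapT => nVx; apply: nAy; apply: (Aup x) => // U oU Ux.
by apply: contrapT => nUy; apply: nVx; exists U.
Qed.

Lemma saturated_open (A : set X) : open A -> saturated A.
Proof. by move=> oA; apply/saturatedP => x y Ax; apply. Qed.

Lemma saturated_bigcup (F : set (set X)) : F `<=` saturated ->
  saturated (\bigcup_(U in F) U).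
Proof.
move=> Fs; apply/saturatedP => x y [U FU Ux] xy; exists U => //.
exact: (proj1 (saturatedP U) (Fs _ FU) x).
Qed.

Lemma saturated_bigcap (F : set (set X)) : F `<=` saturated ->
  saturated (\bigcap_(U in F) U).
Proof.
move=> Fs; apply/saturatedP => x y Fx xy U FU.
by apply: (proj1 (saturatedP U) (Fs _ FU) x) => //; exact: Fx.
Qed.

Definition mk_saturated (A : set X) (sA : saturated A) : saturated_sets :=
  exist _ A (mem_set sA).

Lemma valS_saturated (F : set saturated_sets) : val @` F `<=` saturated.
Proof. by move=> _ [A _ <-]; exact: set_mem (valP A). Qed.

Lemma saturated_leE (A B : saturated_sets) :
  (A <= B) = (val A `<=` val B) :> Prop.
Proof. by rewrite set_type_leE subsetEset. Qed.

Lemma saturated_supE (F : set saturated_sets) S :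
  supremums F S <-> val S = \bigcup_(A in F) val A.
Proof.
pose S0 := mk_saturated (saturated_bigcup (@valS_saturated F)).
have S0E : val S0 = \bigcup_(A in F) val A by rewrite /= bigcup_image.
have S0s : supremums F S0.
  split=> [A FA|B ubB]; rewrite saturated_leE S0E => x.
    by move=> Ax; exists A.
  by case=> A /ubB; rewrite saturated_leE => AB /AB.
split=> [Ss|SE]; first by rewrite (is_subset1_supremums Ss S0s).
by rewrite (_ : S = S0)//; apply: val_inj; rewrite SE S0E.
Qed.

Lemma saturated_infE (F : set saturated_sets) S :
  infimums F S <-> val S = \bigcap_(A in F) val A.
Proof.
pose S0 := mk_saturated (saturated_bigcap (@valS_saturated F)).
have S0E : val S0 = \bigcap_(A in F) val A by rewrite /= bigcap_image.
have S0s : infimums F S0.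
  split=> [A FA|B lbB]; rewrite saturated_leE S0E => x; first exact.
  by move=> Bx A /lbB; rewrite saturated_leE; exact.
split=> [Ss|SE]; first by rewrite (is_subset1_infimums Ss S0s).
by rewrite (_ : S = S0)//; apply: val_inj; rewrite SE S0E.
Qed.

Definition opens := set_type open_sets.

Definition oval (A : opens) : set X := val (val A).

Lemma oval_open (A : opens) : open (oval A).
Proof. exact: set_mem (valP A). Qed.

Definition mk_open (A : set X) (oA : open A) : opens :=
  exist _ (mk_saturated (saturated_open oA)) (mem_set oA).

Lemma oval_inj : injective oval.
Proof. by move=> A B /val_inj/val_inj. Qed.

Lemma opens_leE (A B : opens) : (A <= B) = (oval A `<=` oval B) :> Prop.
Proof. by rewrite set_type_leE saturated_leE. Qed.

Lemma opens_supE (F : set opens) S :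
  supremums F S <-> oval S = \bigcup_(A in F) oval A.
Proof.
have oS : open (\bigcup_(A in F) oval A).
  by apply: bigcup_open => A _; exact: oval_open.
have S0s : supremums F (mk_open oS).
  split=> [A FA|B ubB]; rewrite opens_leE /oval/= => x.
    by move=> Ax; exists A.
  by case=> A /ubB; rewrite opens_leE => AB /AB.
split=> [Ss|SE]; first by rewrite (is_subset1_supremums Ss S0s).
by rewrite (_ : S = mk_open oS)//; apply: oval_inj; rewrite SE.
Qed.

Lemma opens_infE (F : set opens) S :
  infimums F S <-> oval S = interior (\bigcap_(A in F) oval A).
Proof.
have oS : open (interior (\bigcap_(A in F) oval A)) by exact: open_interior.
have S0s : infimums F (mk_open oS).
  split=> [A FA|B lbB]; rewrite opens_leE.
    by move=> x /interior_subset; exact.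
  rewrite -(proj1 (interior_id _) (oval_open B)).
  apply: interiorS => y By A /lbB.
  by rewrite opens_leE; exact.
split=> [Ss|SE]; first by rewrite (is_subset1_infimums Ss S0s).
by rewrite (_ : S = mk_open oS)//; apply: oval_inj; rewrite SE.
Qed.

Lemma opens_finite_infE (F : set opens) S : finite_set F ->
  infimums F S <-> oval S = \bigcap_(A in F) oval A.
Proof.
move=> finF; rewrite opens_infE (_ : interior _ = \bigcap_(A in F) oval A)//.
apply/interior_id; rewrite -bigsetI_fset_set//.
apply: (big_ind open) => [|A B oA oB|A _]; first exact: openT.
  exact: openI.
exact: oval_open.
Qed.

End SpaceRaney.

Section SpaceRaneyTheory.
Variable X : topologicalType.
Local Notation U := (saturated_sets X).
Local Notation O := (opens X).

Lemma opens_is_frame : is_frame O.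
Proof.
split=> [F|a F s m].
  split.
    have oS : open (\bigcup_(A in F) oval A).
      by apply: bigcup_open => A _; exact: oval_open.
    by exists (mk_open oS); apply/opens_supE.
  exists (mk_open (open_interior (\bigcap_(A in F) oval A))).
  exact/opens_infE.
have inf2 (b c i : O) : infimums [set b; c] i <-> oval i = oval b `&` oval c.
  by rewrite opens_finite_infE ?bigcap_setU ?bigcap_set1//; exact: finite_set2.
move=> /opens_supE sE /inf2 mE; apply/opens_supE; rewrite mE sE.
apply/seteqP; split=> [x [ax [A FA Ax]]|x [B [A FA /inf2 BE]]].
  exists (mk_open (openI (oval_open a) (oval_open A))) => //.
  by exists A => //; apply/inf2.
by rewrite BE => -[ax Ax]; split=> //; exists A.
Qed.

Lemma saturated_sup_ex (F : set U) : exists S, supremums F S.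
Proof.
exists (mk_saturated (saturated_bigcup (@valS_saturated X F))).
by apply/saturated_supE; rewrite /= bigcup_image.
Qed.

Lemma saturated_inf_ex (F : set U) : exists S, infimums F S.
Proof.
exists (mk_saturated (saturated_bigcap (@valS_saturated X F))).
by apply/saturated_infE; rewrite /= bigcap_image.
Qed.

Lemma saturated_sup2E (b c i : U) :
  supremums [set b; c] i <-> val i = val b `|` val c.
Proof. by rewrite saturated_supE bigcup_setU !bigcup_set1. Qed.

Lemma saturated_sets_is_coframe : is_coframe U.
Proof.
split=> [F|a F s m].
  by split; [exact: saturated_inf_ex|exact: saturated_sup_ex].
move=> /saturated_infE sE /saturated_sup2E mE.
apply/saturated_infE; rewrite mE sE.
apply/seteqP; split=> [x [ax|Fx] B [A FA /saturated_sup2E ->]|x Fx].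
- by left.
- by right; exact: Fx.
have [ax|nax] := pselect (val a x); [by left|right=> A FA].
have [B BE] := saturated_sup_ex [set a; A].
have : val B x by apply: Fx; exists A.
by move/saturated_sup2E: BE => -> [].
Qed.

Lemma open_sets_frame_map : frame_map (val : O -> U).
Proof.
split=> F S.
  by move=> /opens_supE SE; apply/saturated_supE; rewrite bigcup_image.
move=> finF /(opens_finite_infE _ finF) SE.
by apply/saturated_infE; rewrite bigcap_image.
Qed.

Lemma open_sets_strongly_exact (F : set O) (m : O) :
  strongly_exact_meet F m -> infimums (val @` F : set U) (val m).
Proof.
move=> [/opens_infE mE impF]; apply/saturated_infE; rewrite bigcap_image.
apply/seteqP; split=> [x|x Fx].
  by rewrite -/(oval m) mE => /interior_subset.
rewrite -/(oval m).
have oV : open (~` closure [set x]) by exact/closed_openC/closed_closure.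
have oVE (A : set X) : open A -> A `<=` ~` closure [set x] <-> ~ A x.
  move=> oA; split=> [AV Ax|nAx y Ay cy].
    by apply: (AV _ Ax); exact: subset_closure.
  by have [z [-> //]] := cy _ (open_nbhs_nbhs (conj oA Ay)).
pose V := mk_open oV.
have inf2 (b c i : O) : infimums [set b; c] i <-> oval i = oval b `&` oval c.
  by rewrite opens_finite_infE ?bigcap_setU ?bigcap_set1//; exact: finite_set2.
apply: contrapT => nmx.
have /impF/(_ (mk_open openT) m) : forall A, F A -> is_heyting_imp A V V.
  move=> A FA w i /inf2 iE.
  have Ax : oval A x by exact: Fx.
  apply/idP/idP; rewrite !opens_leE !oVE ?iE; try exact: oval_open;
    try exact: openI (oval_open _) (oval_open _).
    by move=> nwx [].
  by move=> nwx wx; exact: nwx.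
have -> : m <= V by rewrite opens_leE oVE//; exact: oval_open.
have : infimums [set mk_open openT; m] m by apply/inf2/esym; exact: setTI.
move=> /[swap]/[apply] TV; have : mk_open openT <= V by rewrite TV.
by rewrite opens_leE oVE; [exact|exact: openT].
Qed.

Lemma space_is_raney_extension : is_raney_extension (@open_sets X).
Proof.
split.
- exact: saturated_sets_is_coframe.
- exact: opens_is_frame.
- move=> c; have [F Fo cE] := set_mem (valP c).
  exists [set A : U | open (val A) /\ F (val A)] => [A []//|].
  apply/saturated_infE; rewrite cE; apply/seteqP; split=> [x Fx A [_ /Fx]//|].
  move=> x Fx A FA; exact: (Fx (mk_saturated (saturated_open (Fo _ FA)))
    (conj (Fo _ FA) FA)).
- exact: open_sets_frame_map.
- exact: open_sets_strongly_exact.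
Qed.

Definition space_raney : raney_extension := RaneyExtension space_is_raney_extension.

End SpaceRaneyTheory.

Section SpaceMap.
Variables (X Y : topologicalType) (f : continuousType X Y).

Lemma preimage_open (A : set Y) : open A -> open (f @^-1` A).
Proof. by move=> oA; apply: open_comp => // x _; exact: cts_fun. Qed.

Lemma preimage_saturated (A : set Y) : saturated A -> saturated (f @^-1` A).
Proof.
move=> /saturatedP sA; apply/saturatedP => x y Ax xy; apply: (sA (f x)) => // V oV.
exact: (xy _ (preimage_open oV)).
Qed.

Definition saturated_preimage (A : saturated_sets Y) : saturated_sets X :=
  mk_saturated (preimage_saturated (set_mem (valP A))).

Definition open_preimage (A : opens Y) : opens X :=
  mk_open (preimage_open (oval_open A)).

Lemma space_map_is_raney_morphism :
  @raney_morphism (space_raney Y) (space_raney X) saturated_preimage.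
Proof.
split; [split=> F S|exists open_preimage; [|split=> F S]].
- move=> /saturated_infE SE; apply/saturated_infE.
  by rewrite /= SE bigcap_image preimage_bigcap.
- move=> _ /saturated_supE SE; apply/saturated_supE.
  by rewrite /= SE bigcup_image preimage_bigcup.
- by move=> A; apply: val_inj.
- move=> /opens_supE SE; apply/opens_supE.
  by rewrite /oval/= SE bigcup_image preimage_bigcup.
- move=> finF /(opens_finite_infE _ finF) SE.
  apply/opens_finite_infE; first exact: finite_image.
  by rewrite /oval/= SE bigcap_image preimage_bigcap.
Qed.

Definition space_map : raney_hom (space_raney Y) (space_raney X) :=
  exist _ saturated_preimage space_map_is_raney_morphism.

End SpaceMap.

Lemma space_map_id (X : topologicalType) :
  space_map (cts_idm X) = raney_idm (space_raney X).
Proof. by apply: raney_hom_eq => A; apply: val_inj. Qed.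

Lemma space_map_comp (X Y Z : topologicalType) (g : continuousType Y Z)
    (f : continuousType X Y) :
  space_map (cts_comp g f) = raney_comp (space_map f) (space_map g).
Proof. by apply: raney_hom_eq => A; apply: val_inj. Qed.

Definition Omega_R : functor Top (op Raney) :=
  @Functor Top (op Raney) space_raney space_map space_map_id space_map_comp.

Section RaneyTheory.
Variable R : raney_extension.
Local Notation L := (raney_frame R).

Lemma raney_inf_ex (A : set R) : exists m, infimums A m.
Proof. by have [/(_ A)[]] := raney_is_coframe (raneyP R). Qed.

Lemma raney_sup_ex (A : set R) : exists s, supremums A s.
Proof. by have [/(_ A)[]] := raney_is_coframe (raneyP R). Qed.

Lemma raney_frame_sup (A : set R) : A `<=` L ->
  exists2 s, L s & supremums A s.
Proof.
move=> AL; have [frL _] := raney_is_frame (raneyP R).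
have [[s sP] _] := frL [set x | A (val x)].
exists (val s); first exact: set_mem (valP s).
suff -> : A = val @` [set x : set_type L | A (val x)].
  by have [fs _] := raney_frame_map (raneyP R); exact: fs.
apply/seteqP; split=> [x Ax|_ [x Ax <-]//].
by exists (exist _ x (mem_set (AL _ Ax))).
Qed.

Lemma raney_frame_inf (A : set R) : finite_set A -> A `<=` L ->
  exists2 m, L m & infimums A m.
Proof.
move=> finA AL; have [frL _] := raney_is_frame (raneyP R).
have AE : A = val @` [set x : set_type L | A (val x)].
  apply/seteqP; split=> [x Ax|_ [x Ax <-]//].
  by exists (exist _ x (mem_set (AL _ Ax))).
have [_ [m mP]] := frL [set x | A (val x)].
exists (val m); first exact: set_mem (valP m).
rewrite AE; have [_ fi] := raney_frame_map (raneyP R); apply: fi => //.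
apply: (@finite_preimage _ _ A val) => //.
by move=> x y _ _; exact: val_inj.
Qed.

Definition pt : Type := set_type [set x : R | completely_join_prime x].

HB.instance Definition _ := Choice.on pt.

Definition pt_point (x : pt) : R := val x.

Lemma pt_pointP (x : pt) : completely_join_prime (pt_point x).
Proof. exact: set_mem (valP x). Qed.

Definition mk_pt (x : R) (xP : completely_join_prime x) : pt :=
  exist _ x (mem_set xP).

Definition pt_open : set (set pt) :=
  [set V | exists2 a : R, L a & V = [set x | pt_point x <= a]].

Lemma pt_openT : pt_open setT.
Proof.
have [a La [_ aP]] := raney_frame_inf (finite_set0 R) (@sub0set _ _).
exists a => //; apply/seteqP; split=> // x _.
by apply: aP => y.
Qed.

Lemma pt_openI : setI_closed pt_open.
Proof.
move=> _ _ [a La ->] [b Lb ->].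
have [|m Lm [mab mP]] := @raney_frame_inf [set a; b] (finite_set2 _ _).
  by move=> _ [->|->].
exists m => //; apply/seteqP; split=> [x [/= xa xb]|x /= xm].
  by apply: mP => _ [->|->].
by split; apply: le_trans xm _; apply: mab; [left|right].
Qed.

Lemma pt_open_bigcup (I : Type) (F : I -> set pt) :
  (forall i, pt_open (F i)) -> pt_open (\bigcup_i F i).
Proof.
move=> oF; pose A := [set a | L a /\ exists i, F i = [set x | pt_point x <= a]].
have [|s Ls sP] := @raney_frame_sup A; first by move=> a [].
exists s => //; apply/seteqP; split=> [x [i _ Fix]|x /= xs].
  have [a La FE] := oF i; move: Fix; rewrite FE => /le_trans; apply.
  by apply: (proj1 sP); split=> //; exists i.
have [a [La [i FE]] xa] := @pt_pointP x _ _ sP xs.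
by exists i; rewrite ?FE.
Qed.

HB.instance Definition _ :=
  isOpenTopological.Build pt pt_openT pt_openI pt_open_bigcup.

Lemma open_ptE (V : set pt) : open V <->
  exists2 a : R, raney_frame R a & V = [set x : pt | pt_point x <= a].
Proof. by []. Qed.

End RaneyTheory.

Section LeftAdjoint.
Variables (R S : raney_extension) (f : raney_hom R S).

Lemma raney_hom_homo : {homo sval f : x y / x <= y}.
Proof.
move=> x y xy; have [[_ fs] _] := svalP f.
have /(fs _ _ (finite_set2 x y))[+ _] : supremums [set x; y] y.
  by split=> [_ [->|->]|z]//; apply; right.
by apply; exists x => //; left.
Qed.

Lemma left_adjoint_ex : {g : S -> R | left_adjoint g (sval f)}.
Proof.
apply: cid; have /choice[g gP] (y : S) :
    exists m, infimums [set x | y <= sval f x] m by exact: raney_inf_ex.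
exists g => y x; apply/idP/idP => [gyx|]; last exact: (proj1 (gP y)).
apply: le_trans (raney_hom_homo gyx).
have [[fi _] _] := svalP f; have [_] := fi _ _ (gP y); apply.
by move=> _ [z yz <-].
Qed.

Definition raney_left_adjoint : S -> R := sval left_adjoint_ex.

Lemma raney_left_adjointP : left_adjoint raney_left_adjoint (sval f).
Proof. exact: svalP left_adjoint_ex. Qed.

Lemma raney_left_adjoint_cjp (y : S) :
  completely_join_prime y -> completely_join_prime (raney_left_adjoint y).
Proof.
move=> yP A s sA gys; apply: contrapT => nA.
pose B := [set b | raney_frame R b /\ ~~ (raney_left_adjoint y <= b)].
have [|t Lt tB] := @raney_frame_sup R B; first by move=> b [].
have st : s <= t.
  apply: (proj2 sA) => a Aa.
  have [D DL Da] := raney_dense (raneyP R) a.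
  have [b Db gyb] : exists2 b, D b & ~~ (raney_left_adjoint y <= b).
    apply: contrapT => nD; apply: nA; exists a => //.
    apply: (proj2 Da) => b Db; apply: contrapT => /negP gyb.
    by apply: nD; exists b.
  apply: le_trans (proj1 Da _ Db) _; apply: (proj1 tB).
  by split=> //; exact: DL.
have : y <= sval f t by rewrite -raney_left_adjointP (le_trans gys).
have [_ [g gE [gs _]]] := svalP f.
pose B' := [set b : set_type (raney_frame R) | B (val b)].
have ftB : supremums (sval f @` B) (sval f t).
  have BE : B = val @` B'.
    apply/seteqP; split=> [b Bb|_ [b Bb <-]//].
    by exists (exist _ b (mem_set (proj1 Bb))).
  pose t' : set_type (raney_frame R) := exist _ t (mem_set Lt).
  have tB' : supremums B' t'.
    split=> [b Bb|u ub]; rewrite set_type_leE; first exact: (proj1 tB).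
    by apply: (proj2 tB) => b; rewrite {1}BE => -[b' /ub + <-].
  have [+ _] := raney_frame_map (raneyP S) => /(_ _ _ (gs _ _ tB')).
  rewrite gE /= BE !image_comp.
  by rewrite (_ : val \o g = sval f \o val)//; apply/funext => b; exact: gE.
move=> /(yP _ _ ftB)[_ [b [_ /negP nb] <-]].
by rewrite -raney_left_adjointP.
Qed.

Definition pt_map_fun (y : pt S) : pt R :=
  mk_pt (raney_left_adjoint_cjp (@pt_pointP S y)).

Lemma pt_map_continuous : continuous pt_map_fun.
Proof.
apply/continuousP => _ /open_ptE[a La ->]; apply/open_ptE.
have [_ [g gE _]] := svalP f.
exists (sval f a).
  pose a' : set_type (raney_frame R) := exist _ a (mem_set La).
  by rewrite -(gE a'); exact: set_mem (valP (g a')).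
by apply/seteqP; split=> y; rewrite /= raney_left_adjointP.
Qed.

Definition pt_map : continuousType (pt S) (pt R) := mkcts pt_map_continuous.

End LeftAdjoint.

Lemma left_adjoint_unique d d' (T : porderType d) (U : porderType d')
    (f : T -> U) (g g' : U -> T) :
  left_adjoint g f -> left_adjoint g' f -> g =1 g'.
Proof.
by move=> gP g'P y; apply/le_anti; rewrite gP -g'P lexx/= g'P -gP lexx.
Qed.

Lemma pt_map_id (R : raney_extension) : pt_map (raney_idm R) = cts_idm (pt R).
Proof.
apply: cts_eq => y; apply: val_inj.
exact: (left_adjoint_unique (g' := id) (raney_left_adjointP (raney_idm R))).
Qed.

Lemma pt_map_comp (R S T : raney_extension) (g : raney_hom S T)
    (f : raney_hom R S) :
  pt_map (raney_comp g f) = cts_comp (pt_map f) (pt_map g).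
Proof.
apply: cts_eq => y; apply: val_inj.
apply: (left_adjoint_unique
  (g' := raney_left_adjoint f \o raney_left_adjoint g)
  (raney_left_adjointP (raney_comp g f))).
by move=> {}y x; rewrite /= !raney_left_adjointP.
Qed.

Definition pt_R : functor (op Raney) Top :=
  @Functor (op Raney) Top (fun R => pt R : topologicalType)
    (fun R S (f : raney_hom S R) => pt_map f) pt_map_id
    (fun R S T (g : raney_hom T S) (f : raney_hom S R) => pt_map_comp f g).

Definition spatial_raney (R : op Raney) : Prop :=
  exists X : topologicalType, @isomorphic Raney R (space_raney X).

(* Main.v *)
Require Import Defs.
From mathcomp Require Import all_boot all_order.
From mathcomp Require Import boolp classical_sets cardinality filter topology.

(** A point [x] of a space [X] is recorded by the principal upset [upset x] of the
    specialization preorder: a saturated set [A] contains [x] exactly when it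
    contains [upset x] ([upset_leE]). Dually an element [a] of a Raney extension
    [R] is recorded by the set of points of [R] lying below it. These two
    assignments are the unit [X -> pt (Omega X)] and the counit
    [R -> Omega (pt R)], read in [Raney]. All the categorical identities are
    instances of one rule: a point is determined by the elements above it
    ([pt_eq]), the elements above the unit at [x] are the saturated sets
    containing [x], and the elements above [pt_map f p] are those sent by [f]
    above [p] ([pt_map_leE], the adjunction defining [f^*]).

    The fixpoints come from two facts. Every saturated set is the union of the
    principal upsets of its points, so a completely join-prime one is itself
    principal: the unit is always surjective ([unit_surj]). Moreover every open
    set of [X] is the preimage of an open set of points. So the unit is an
    isomorphism as soon as it is injective, which is the T0 axiom; the space of
    points of any [R] is T0 because its opens come from [L], which generates
    [R] under meets ([pt_kolmogorov]). Surjectivity of the unit also makes the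
    inverse image along it invert the counit at [Omega X] ([counit_space_iso]).
    Finally, being a fixpoint of the counit is invariant under isomorphism, by
    naturality, which identifies these fixpoints with the Raney extensions
    isomorphic to one coming from a space. The restricted equivalence is then
    read off the descriptions of the fixpoints. *)

Set Implicit Arguments.
Unset Strict Implicit.
Unset Printing Implicit Defensive.

Import Order.TTheory.

Local Open Scope classical_set_scope.
Local Open Scope order_scope.

(** * Isomorphisms and fixpoints in an arbitrary category *)

Section Isomorphisms.
Variable C : category.

Lemma is_iso_idm (X : C) : is_iso (idm X).
Proof. by exists (idm X); rewrite comp_idl. Qed.

Lemma is_iso_comp (X Y Z : C) (g : hom Y Z) (f : hom X Y) :
  is_iso g -> is_iso f -> is_iso (Defs.comp g f).
Proof.
move=> [g' [g'g gg']] [f' [f'f ff']]; exists (Defs.comp f' g'); split.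
  by rewrite -comp_assoc (comp_assoc g') g'g comp_idl.
by rewrite -comp_assoc (comp_assoc f) ff' comp_idl.
Qed.

Lemma is_iso_op (X Y : C) (f : @hom C X Y) :
  @is_iso C X Y f -> @is_iso (op C) Y X f.
Proof. by move=> [g [gf fg]]; exists g. Qed.

End Isomorphisms.

Lemma is_iso_fmap (C D : category) (F : functor C D) (X Y : C) (f : hom X Y) :
  is_iso f -> is_iso (Defs.fmap F f).
Proof.
move=> [g [gf fg]]; exists (Defs.fmap F g).
by rewrite -!Defs.fmap_comp gf fg !Defs.fmap_id.
Qed.

Lemma counit_fixpoint_iso (C D : category) (F : functor C D) (G : functor D C)
    (A : adjunction F G) (Y Y' : D) (f : hom Y Y') :
  is_iso f -> counit_fixpoint A Y -> counit_fixpoint A Y'.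
Proof.
move=> isof isoY; have [g [gf fg]] := isof.
have isog : is_iso g by exists f.
(* naturality writes the counit at Y' as f o counit Y o F (G g) *)
rewrite /counit_fixpoint -(comp_idl (adj_counit A Y')) -fg -comp_assoc.
rewrite adj_counit_nat.
by apply: is_iso_comp => //; apply: is_iso_comp => //; do 2 apply: is_iso_fmap.
Qed.

(** * The principal upset of a point of a space *)

(** In this form the T0 axiom says that a point can be recovered from its open
    neighbourhoods, so it compares directly with the injectivity of the unit. *)
Lemma kolmogorovP (X : topologicalType) : kolmogorov_space X <->
  forall x y : X, (forall U, open U -> U x <-> U y) -> x = y.
Proof.
split=> [T0 x y xy|T0 x y /eqP xy].
  have sep (a b : X) (U : set X) : (forall V, open V -> V a <-> V b) ->
      ~ (U \in nbhs a /\ b \in ~` U).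
    move=> ab [/set_mem aU /set_mem]; apply.
    apply: (@interior_subset _ U); apply/(ab _ (open_interior U)).
    exact: aU.
  apply/eqP/negPn/negP => /T0[U [|]]; first exact: sep.
  by apply: sep => V oV; rewrite -(xy V oV).
apply: contrapT => nA; apply: xy; apply: T0 => U oU.
split=> Ux; apply: contrapT => nUy; apply: nA; exists U; [left|right].
  by split; apply: mem_set => //; exact: open_nbhs_nbhs.
by split; apply: mem_set => //; exact: open_nbhs_nbhs.
Qed.

Section PrincipalUpset.
Variable X : topologicalType.

Lemma saturated_upset (x : X) :
  saturated [set y | forall U, open U -> U x -> U y].
Proof. by apply/saturatedP => y z xy yz U oU /(xy _ oU)/(yz _ oU). Qed.

Definition upset (x : X) : space_raney X := mk_saturated (saturated_upset x).

Lemma upset_leE (x : X) (A : space_raney X) : upset x <= A <-> val A x.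
Proof.
have /saturatedP As := set_mem (valP A).
rewrite saturated_leE; split=> [xA|Ax y xy]; first exact: xA.
exact: (As x).
Qed.

Lemma upset_cjp (x : X) : completely_join_prime (upset x).
Proof.
move=> F S /saturated_supE SE /upset_leE; rewrite SE => -[A FA Ax].
by exists A => //; apply/upset_leE.
Qed.

(** A completely join-prime saturated set is below one of the principal
    upsets whose union it is. *)
Lemma cjp_is_upset (A : space_raney X) :
  completely_join_prime A -> exists x, A = upset x.
Proof.
move=> Ap; have Asup : supremums (upset @` val A) A.
  apply/saturated_supE; rewrite bigcup_image; apply/seteqP; split=> [x Ax|x].
    by exists x => //; apply/upset_leE.
  by move=> [y /upset_leE]; rewrite saturated_leE => yA /yA.
have [_ [x Ax <-] Ax'] := Ap _ _ Asup (lexx A).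
by exists x; apply/le_anti; rewrite Ax'/=; apply/upset_leE.
Qed.

Definition unit_fun (x : X) : pt (space_raney X) := mk_pt (@upset_cjp x).

Lemma unit_leE (x : X) (A : space_raney X) :
  pt_point (unit_fun x) <= A <-> val A x.
Proof. exact: upset_leE. Qed.

Lemma unit_surj (p : pt (space_raney X)) : exists x, unit_fun x = p.
Proof.
have [x px] := cjp_is_upset (@pt_pointP _ p).
by exists x; apply: val_inj.
Qed.

Lemma unit_continuous : continuous unit_fun.
Proof.
apply/continuousP => _ /open_ptE[A oA ->].
by rewrite (_ : _ @^-1` _ = val A)//; apply/seteqP; split=> x /unit_leE.
Qed.

Definition unit_map : continuousType X (pt (space_raney X)) :=
  mkcts unit_continuous.

End PrincipalUpset.

(** * The points below an element of a Raney extension *)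

Lemma pt_eq (R : raney_extension) (p q : pt R) :
  (forall a, pt_point p <= a <-> pt_point q <= a) -> p = q.
Proof.
by move=> pq; apply/val_inj/le_anti/andP; split; [apply/pq|apply/pq].
Qed.

Lemma pt_map_leE (R S : raney_extension) (f : raney_hom R S) (p : pt S) a :
  pt_point (pt_map f p) <= a <-> pt_point p <= sval f a.
Proof. by rewrite [X in is_true X <-> _]raney_left_adjointP. Qed.

(** Since [L] generates [R] under meets, two points below the same elements of
    [L] are below the same elements of [R]. *)
Lemma pt_kolmogorov (R : raney_extension) : kolmogorov_space (pt R).
Proof.
apply/kolmogorovP => p q pq; apply: pt_eq => a.
have [A AL [aA Aa]] := raney_dense (raneyP R) a.
have pqL b : A b -> pt_point p <= b <-> pt_point q <= b.
  by move=> Ab; apply: (pq [set r | pt_point r <= b]); exists b => //; exact: AL.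
by split=> /le_trans ra; apply: Aa => b Ab; apply/(pqL _ Ab); exact/ra/aA.
Qed.

Section Counit.
Variable R : raney_extension.
Local Notation L := (raney_frame R).

Lemma saturated_below (a : R) : saturated [set p : pt R | pt_point p <= a].
Proof.
apply/saturatedP => p q /= pa pq.
have [A AL [aA Aa]] := raney_dense (raneyP R) a.
apply: Aa => b Ab; apply: (pq [set r | pt_point r <= b]).
  by exists b => //; exact: AL.
exact/(le_trans pa)/aA.
Qed.

Definition below (a : R) : space_raney (pt R) :=
  mk_saturated (saturated_below a).

Lemma open_below (a : set_type L) :
  open [set p : pt R | pt_point p <= val a].
Proof. by exists (val a) => //; exact: set_mem (valP a). Qed.

Lemma below_sup (A : set R) s : supremums A s ->
  [set p : pt R | pt_point p <= s] =
  \bigcup_(a in A) [set p | pt_point p <= a].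
Proof.
move=> sA; apply/seteqP; split=> [p /(pt_pointP sA)[a Aa pa]|p [a Aa /= pa]].
  by exists a.
exact/(le_trans pa)/(proj1 sA).
Qed.

Lemma below_inf (A : set R) m : infimums A m ->
  [set p : pt R | pt_point p <= m] =
  \bigcap_(a in A) [set p | pt_point p <= a].
Proof.
move=> [mA Am]; apply/seteqP; split=> [p /= pm a Aa|p pA].
  exact/(le_trans pm)/mA.
by apply: Am => a /pA.
Qed.

(** Joins are preserved because points are completely join-prime, meets because
    being below a meet is being below each term. No separate argument is needed
    on [L], whose joins and finite meets are computed in [R]. *)
Lemma below_is_raney_morphism :
  @raney_morphism R (space_raney (pt R)) below.
Proof.
have [Ls Li] := raney_frame_map (raneyP R).
split; [split=> A m|exists (fun a => mk_open (open_below a)); [|split=> A m]].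
- by move=> /below_inf mE; apply/saturated_infE; rewrite bigcap_image.
- by move=> _ /below_sup mE; apply/saturated_supE; rewrite bigcup_image.
- by move=> a; apply: val_inj.
- move=> /Ls/below_sup mE; apply/opens_supE.
  by rewrite /oval/= mE !bigcup_image.
- move=> finA /(Li _ _ finA)/below_inf mE.
  apply/opens_finite_infE; first exact: finite_image.
  by rewrite /oval/= mE !bigcap_image.
Qed.

Definition below_hom : raney_hom R (space_raney (pt R)) :=
  exist _ below below_is_raney_morphism.

End Counit.

(** * The adjunction *)

Lemma unit_nat (X Y : topologicalType) (f : continuousType X Y) :
  cts_comp (unit_map Y) f = cts_comp (pt_map (space_map f)) (unit_map X).
Proof.
apply: cts_eq => x; apply: pt_eq => A; rewrite pt_map_leE.
by split=> /unit_leE ?; apply/unit_leE.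
Qed.

Lemma below_nat (R S : raney_extension) (f : raney_hom R S) :
  raney_comp (below_hom S) f = raney_comp (space_map (pt_map f)) (below_hom R).
Proof.
apply: raney_hom_eq => a; apply: val_inj; apply/seteqP.
by split=> p /pt_map_leE.
Qed.

Lemma unit_below (X : topologicalType) :
  raney_comp (space_map (unit_map X)) (below_hom (space_raney X)) =
  raney_idm (space_raney X).
Proof.
apply: raney_hom_eq => A; apply: val_inj.
by apply/seteqP; split=> x /unit_leE.
Qed.

Lemma below_unit (R : raney_extension) :
  cts_comp (pt_map (below_hom R)) (unit_map (pt R)) = cts_idm (pt R).
Proof.
apply: cts_eq => p; apply: pt_eq => a; rewrite pt_map_leE.
exact: unit_leE.
Qed.

Definition raney_adjunction : adjunction Omega_R pt_R :=
  @Adjunction Top (op Raney) Omega_R pt_R unit_map below_hom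
    unit_nat (fun R S f => below_nat f) unit_below below_unit.

(** * The fixpoints *)

(** The unit being surjective, and each open [U] being the preimage of the open
    set of points below [U], injectivity suffices; and the unit at [x]
    remembers the open sets containing [x] and nothing more. *)
Lemma unit_isoP (X : Top) :
  unit_fixpoint raney_adjunction X <-> kolmogorov_space X.
Proof.
split=> [[g [gK _]]|T0].
  apply/kolmogorovP => x y xy.
  have {}gK z : g (unit_map X z) = z.
    exact: (congr1 (fun h : continuousType X X => h z) gK).
  rewrite -(gK x) -(gK y); congr (g _).
  suff xyA (A : space_raney X) : val A x <-> val A y.
    by apply: pt_eq => A; split=> /unit_leE Ax; apply/unit_leE/xyA.
  have /saturatedP As := set_mem (valP A).
  split=> [Ax|Ay]; first by apply: (As x) => // U oU; rewrite (xy U oU).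
  by apply: (As y) => // U oU; rewrite (xy U oU).
have [g gK] := choice (@unit_surj X).
have unit_inj : injective (@unit_fun X).
  move=> x y xy; apply: (proj1 (kolmogorovP X) T0) => U oU.
  pose A : space_raney X := mk_saturated (saturated_open oU).
  have UE z : pt_point (unit_fun z) <= A <-> U z by exact: unit_leE.
  by rewrite -!UE xy.
have g_cts : continuous g.
  apply/continuousP => U oU; exists (mk_saturated (saturated_open oU)) => //.
  apply/seteqP; split=> p /= => [Ug|pU]; first by rewrite -(gK p); apply/unit_leE.
  by apply/(unit_leE _ (mk_saturated (saturated_open oU))); rewrite gK.
exists (mkcts g_cts : continuousType _ _); split.
  by apply: cts_eq => x; apply: unit_inj; exact: gK.
by apply: cts_eq => p; exact: gK.
Qed.

(** One composite is a triangle identity; the other compares two saturated sets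
    of points, and every point is of the form [unit_fun x]. *)
Lemma counit_space_iso (X : Top) :
  counit_fixpoint raney_adjunction (Omega_R X).
Proof.
exists (space_map (unit_map X)); split; last exact: unit_below.
apply: raney_hom_eq => B; apply: val_inj; apply/seteqP.
split=> p /=; have [x <-] := unit_surj p; first by move/unit_leE.
by move=> Bx; apply/unit_leE.
Qed.

Lemma counit_isoP (R : op Raney) :
  counit_fixpoint raney_adjunction R <-> spatial_raney R.
Proof.
split=> [[g [gK Kg]]|[X [f /is_iso_op fiso]]].
  by exists (pt R : topologicalType), (below_hom R), g.
exact: counit_fixpoint_iso fiso (counit_space_iso X).
Qed.

Lemma spatial_space (X : Top) : spatial_raney (Omega_R X).
Proof. by exists X, (idm (Omega_R X : Raney)); exact: is_iso_idm. Qed.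

Theorem theorem3p9 :
  exists A : adjunction Omega_R pt_R,
    [/\ idempotent_adjunction A,
        forall X : Top, unit_fixpoint A X <-> kolmogorov_space X,
        forall R : op Raney, counit_fixpoint A R <-> spatial_raney R &
        exists (T0_space : forall X : Top,
                  kolmogorov_space X -> spatial_raney (Omega_R X))
               (space_T0 : forall R : op Raney,
                  spatial_raney R -> kolmogorov_space (pt_R R)),
          is_equivalence (restrict_adjunction A T0_space space_T0)].
Proof.
exists raney_adjunction; split.
- split=> [R|X]; first exact/unit_isoP/pt_kolmogorov.
  exact: counit_space_iso.
- exact: unit_isoP.
- exact: counit_isoP.
exists (fun X _ => spatial_space X), (fun R _ => @pt_kolmogorov R).
split=> [[X T0]|[R spR]].
  by have [g gP] := proj2 (unit_isoP X) T0; exists g.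
by have [g gP] := proj2 (counit_isoP R) spR; exists g.
Qed.
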